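(* For every odd positive integer $k$ and every positive integer $n$, $$S_n(M_k)\le (2.25\,k^2)^n.$$
   Context: Permutations of length $n$ ($n$-permutations) are written in one-line notation $p=p_1p_2\cdots p_n$. Let $k,n$ be positive integers. A permutation $p=p_1\cdots p_n$ avoids the pattern $q=q_1q_2\cdots q_k$ (a permutation of length $k$) if there are no indices $i_1<i_2<\cdots<i_k$ such that for all $a,b$ the inequality $p_{i_a}<p_{i_b}$ holds if and only if $q_a<q_b$ (in particular every $p$ with $n<k$ avoids $q$). $S_n(q)$ denotes the number of permutations of length $n$ that avoid $q$. For $m\ge 1$, let $M_{2m}$ denote the pattern $1\,3\,2\,5\,4\cdots(2m-1)(2m-2)\,2m$ of length $2m$, i.e. the permutation of $\{1,\dots,2m\}$ that fixes $1$ and $2m$ and interchanges $2i$ and $2i+1$ for each $1\le i\le m-1$. The pattern $M_{2m-1}$ is obtained from $M_{2m}$ by removing the first entry $1$ and decreasing all other entries by $1$; that is, $M_{2m-1}=2\,1\,4\,3\cdots(2m-2)(2m-3)(2m-1)$. Thus $M_1=1$, $M_3=213$, $M_5=21435$. *)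

(* Defs.v *)
From mathcomp Require Import all_boot all_fingroup.

Set Implicit Arguments.
Unset Strict Implicit.
Unset Printing Implicit Defensive.

(* A pattern is a permutation of {1, ..., k} given by its one-line notation, a
   sequence of naturals. A permutation p : 'S_n acts on {0, ..., n.-1} rather
   than {1, ..., n}; containment only compares entries, so the shift is
   harmless. *)
Definition contains (n : nat) (p : 'S_n) (q : seq nat) : bool :=
  [exists i : {ffun 'I_(size q) -> 'I_n},
    [forall a : 'I_(size q), forall b : 'I_(size q), (a < b) ==> (i a < i b)] &&
    [forall a : 'I_(size q), forall b : 'I_(size q),
       (p (i a) < p (i b)) == (nth 0 q a < nth 0 q b)]].

Definition avoids (n : nat) (p : 'S_n) (q : seq nat) : bool := ~~ contains p q.

Definition num_avoiders (n : nat) (q : seq nat) : nat :=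
  #|[set p : 'S_n | avoids p q]|.

(* 1 3 2 5 4 ... (2m-1) (2m-2) 2m, for m >= 1 *)
Definition M_even (m : nat) : seq nat :=
  1 :: flatten [seq [:: i.*2.+1; i.*2] | i <- iota 1 m.-1] ++ [:: m.*2].

(* M_k for k >= 1. For odd k = 2m-1, M_k is M_(2m) with its first entry 1 removed
   and the other entries decreased by 1. *)
Definition M (k : nat) : seq nat :=
  if odd k then [seq x.-1 | x <- behead (M_even k.+1./2)] else M_even k./2.

Lemma M_even_perm (m : nat) : 0 < m -> perm_eq (M_even m) (iota 1 m.*2).
Proof.
case: m => // m _; rewrite /M_even succnK doubleS /= perm_cons.
rewrite -[_ :: iota 3 _]/(iota 2 m.*2.+1).
have -> : iota 2 m.*2.+1 = iota 2 m.*2 ++ [:: m.*2.+2].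
  by rewrite -(addn1 m.*2) iotaD /= add2n addn1.
rewrite perm_cat2r.
suff H j : perm_eq (flatten [seq [:: i.*2.+1; i.*2] | i <- iota j m])
                   (iota j.*2 m.*2) by exact: (H 1).
elim: m j => [|m IHm] j //; rewrite doubleS /=.
rewrite (perm_catCA [:: _] [:: _]) /= !perm_cons.
exact: (IHm j.+1).
Qed.

Lemma M_perm (k : nat) : 0 < k -> perm_eq (M k) (iota 1 k).
Proof.
move=> k_gt0; rewrite /M; case: ifPn => [k_odd | k_even]; last first.
  have := M_even_perm (m := k./2); rewrite even_halfK //; apply.
  by rewrite half_gt0; case: k k_gt0 k_even => [|[]].
have := M_even_perm (m := k.+1./2); rewrite even_halfK /= ?k_odd //.
rewrite perm_cons => H.
have -> : iota 1 k = [seq x.-1 | x <- iota 2 k].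
  by rewrite (iotaDl 1 1) -map_comp map_id_in.
by apply/perm_map/H; rewrite uphalf_gt0.
Qed.

Example M1E : M 1 = [:: 1]. Proof. by []. Qed.
Example M3E : M 3 = [:: 2; 1; 3]. Proof. by []. Qed.
Example M5E : M 5 = [:: 2; 1; 4; 3; 5]. Proof. by []. Qed.
Example M6E : M 6 = [:: 1; 3; 2; 5; 4; 6]. Proof. by []. Qed.

(* Main.v *)
(* Write M_(2m+1) as m blocks 21 followed by a 1.

   If p avoids 21 + 21 + r (direct sums), its entries split into a red part
   avoiding 2143 and a blue part avoiding 21 + r: scan from left to right, and
   colour an entry blue when it lies above an earlier blue entry or when it
   would complete a red 2143.

   A 2143-avoider is determined by the positions and the values of three
   classes of entries. Those with a 21 to their upper right are forced by the
   remaining ones, scanning from right to left. The remaining entries avoid 132;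
   among them, those which are not left-to-right minima are forced by the
   minima, scanning from left to right, and the minima are decreasing.

   Iterating, an avoider of M_(2m+1) is determined by one colouring of its
   positions and one of its values with 3m colours, and 3m <= 1.5 (2m+1). *)
Require Import Defs.
From mathcomp Require Import all_boot all_order all_algebra all_fingroup.
From mathcomp Require Import zify lra.
Import Order.TTheory GRing.Theory Num.Theory.

Local Open Scope ring_scope.

Section Coding.
Set Implicit Arguments.
Unset Strict Implicit.
Local Open Scope nat_scope.
Context {n : nat}.
Implicit Types (p q : 'S_n) (A R X : {set 'I_n}) (c d : 'I_n -> nat).

(** * Occurrences of the pattern *)

(* An occurrence of M_(2m+1) among the entries of p at positions in A, using
   only positions >= a and values >= b. *)
Fixpoint occurs m p A (a b : nat) : Prop :=
  if m is m'.+1 then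
    exists x y, [/\ x \in A, y \in A, a <= x < y, b <= p y < p x
                  & occurs m' p A y.+1 (p x).+1]
  else exists2 x, x \in A & (a <= x) && (b <= p x).

Lemma occurs_mono m p A A' a a' b b' :
  A \subset A' -> a' <= a -> b' <= b -> occurs m p A a b -> occurs m p A' a' b'.
Proof.
move=> /subsetP sA; elim: m a a' b b' => [|m IHm] a a' b b' la lb /=.
  by case=> x xA xab; exists x; [exact: sA | lia].
case=> x [y [xA yA xy pxy E]]; exists x, y; split; try exact: sA; try lia.
exact: (IHm _ _ _ _ _ _ E).
Qed.

Lemma M_odd m :
  M m.*2.+1 = flatten [seq [:: i.*2; i.*2.-1] | i <- iota 1 m] ++ [:: m.*2.+1].
Proof.
rewrite /M /= odd_double /= doubleK /M_even /= map_cat; congr (_ ++ _).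
by rewrite map_flatten -map_comp; congr flatten.
Qed.

(** Mirrors the recursion of [occurs]: one block 21, then the shorter pattern to its upper right. *)
Lemma M_oddS m : M m.+1.*2.+1 = 2 :: 1 :: [seq x.+2 | x <- M m.*2.+1].
Proof.
rewrite !M_odd /= map_cat /= map_flatten -map_comp (iotaDl 1 1) -map_comp.
congr [:: _, _ & flatten _ ++ _]; apply/eq_in_map => i.
by rewrite mem_iota; case: i.
Qed.

Lemma occurs_seq m p A a b : occurs m p A a b ->
  exists s : seq 'I_n,
    [/\ size s = size (M m.*2.+1), sorted ltn (map val s),
        {in s, forall x : 'I_n, (a <= x) && (b <= p x)}
      & forall x0 i j, i < size s -> j < size s ->
          nth 0 (M m.*2.+1) i < nth 0 (M m.*2.+1) j ->
          p (nth x0 s i) < p (nth x0 s j)].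
Proof.
elim: m a b => [|m IHm] a b.
  case=> x _ xab; exists [:: x]; split=> //.
    by move=> z; rewrite inE => /eqP->.
  by move=> x0 [|i] [|j].
case=> x [y [_ _ xy pxy /IHm[s [sz_s srt_s ge_s ord_s]]]].
exists [:: x, y & s]; rewrite M_oddS; split.
- by rewrite /= size_map sz_s.
- rewrite /= (andP xy).2 /= path_sortedE; last exact: ltn_trans.
  rewrite srt_s andbT all_map; apply/allP => z /ge_s /= ?; lia.
- by move=> z; rewrite !inE => /or3P[/eqP-> | /eqP-> | /ge_s ?]; lia.
move=> x0 i j; case: i => [|[|i]] /=; case: j => [|[|j]] //=; rewrite ?ltnS.
- by move=> _ /(mem_nth x0)/ge_s/andP[].
- lia.
- by move=> _ /(mem_nth x0)/ge_s/andP[_ lt_s] _; apply: ltn_trans lt_s; lia.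
- by move=> i_s _; rewrite (nth_map 0) -?sz_s.
- by move=> i_s _; rewrite (nth_map 0) -?sz_s.
move=> i_s j_s; rewrite !(nth_map 0) -?sz_s // !ltnS; exact: ord_s.
Qed.

Lemma occurs_contains m p : occurs m p setT 0 0 -> contains p (M m.*2.+1).
Proof.
case/occurs_seq=> s [sz_s srt_s _ ord_s].
have M_uniq : uniq (M m.*2.+1) by rewrite (perm_uniq (M_perm _)) // iota_uniq.
have [x0 _] : exists x0 : 'I_n, true.
  case: s sz_s {srt_s ord_s} => [|x s _]; last by exists x.
  by rewrite M_odd size_cat addn1.
apply/existsP; exists [ffun i : 'I_(size (M m.*2.+1)) => nth x0 s i].
apply/andP; split; apply/forallP => a; apply/forallP => b; rewrite !ffunE.
  have [la lb] : a < size s /\ b < size s by rewrite sz_s.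
  apply/implyP => ab; rewrite -!(nth_map x0 0 val) //.
  by apply: (sorted_ltn_nth ltn_trans 0 srt_s) => //; rewrite inE size_map.
have [la lb] : a < size s /\ b < size s by rewrite sz_s.
(* The pattern has distinct entries, so [ord_s] with [a] and [b] swapped gives the converse. *)
apply/eqP; apply/idP/idP; last exact: ord_s.
case: (ltngtP (nth 0 (M m.*2.+1) a)) => // [/(ord_s x0 _ _ lb la)|/eqP]; first lia.
by rewrite nth_uniq // => /eqP->; rewrite ltnn.
Qed.

(** * Splitting into red and blue entries *)

Definition avoids2143 p R := forall a b x y,
  a \in R -> b \in R -> x \in R -> y \in R ->
  a < b < x -> x < y -> p b < p a < p y -> p y < p x -> False.

(** [x y z b'] is a 2143 in which only [b'] is blue, and [b] is [b'] or lies to its upper right.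
    Hence the red 21 [x y] is to the lower left of [b]. *)
Definition blue_witness p A R (b : 'I_n) : Prop := exists b' x y z,
  [/\ b' \in A :\: R, [&& x \in R, y \in R & z \in R],
      [&& x < y, y < z, z < b' & b' <= b],
      p y < p x < p b' & p b' <= p b /\ p b' < p z].

(* The state of the scan once positions < t are coloured, R being the red ones
   among them. *)
Definition greedy p A (t : nat) R : Prop :=
  [/\ R \subset A,
      {in R, forall r : 'I_n, r < t},
      avoids2143 p R,
      forall b r, b \in A :\: R -> b < t -> r \in R -> b < r -> p r < p b
    & forall b, b \in A :\: R -> b < t -> blue_witness p A R b].

Lemma greedy_exists p A t : exists R, greedy p A t R.
Proof.
elim: t => [|t [R [sRA ltRt avR aboveR blueR]]].
  exists set0; split; rewrite ?sub0set //.
  - by move=> r; rewrite inE.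
  by move=> a b x y; rewrite inE.
have keep : (forall b : 'I_n, b = t :> nat -> b \in A :\: R ->
    blue_witness p A R b) -> exists R, greedy p A t.+1 R.
  move=> blue_t; exists R; split=> //.
  - by move=> r /ltRt; lia.
  - by move=> b r bB bt rR br; apply: aboveR => //; have := ltRt r rR; lia.
  move=> b bB; rewrite ltnS leq_eqVlt => /orP[/eqP bt | ]; first exact: blue_t.
  exact: blueR.
have [tn | nt] := ltnP t n; last by apply: keep => b bt; have := ltn_ord b; lia.
have [u ut] : exists u : 'I_n, u = t :> nat by exists (Ordinal tn).
have u_uniq (b : 'I_n) : b = t :> nat -> b = u.
  by rewrite -ut => bt; apply: val_inj.
have [uA | uA] := boolP (u \in A); last first.
  by apply: keep => b /u_uniq->; rewrite inE (negPf uA) andbF.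
have uR : u \notin R by apply/negP => /ltRt; rewrite ut ltnn.
have uB : u \in A :\: R by rewrite inE uR.
have [/existsP[b /and3P[bB bu pbu]] | no_blue] :=
    boolP [exists b : 'I_n, [&& b \in A :\: R, b < t & p b < p u]].
  (* The earlier and smaller blue [b] passes its witness on to [u]. *)
  apply: keep => _ /u_uniq-> _.
  have [b' [x [y [z [b'B xyzR pos pyx [pb'b pb'z]]]]]] := blueR b bB bu.
  case/and4P: pos => xy yz zb' b'b; exists b', x, y, z; split=> //.
    by rewrite xy yz zb' ut (leq_trans b'b) // ltnW.
  by split=> //; apply: leq_trans pb'b (ltnW pbu).
have [/existsP[x /existsP[y /existsP[z]]] | no_red] :=
    boolP [exists x : 'I_n, exists y : 'I_n, exists z : 'I_n,
      [&& x \in R, y \in R, z \in R, x < y < z, p y < p x < p u & p u < p z]].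
  case/and4P=> xR yR zR /and3P[xyz pxyz pz]; apply: keep => _ /u_uniq-> _.
  (* Here [u] would complete a red 2143, so it is its own witness. *)
  exists u, x, y, z; rewrite xR yR zR; split=> //.
  by have := ltRt z zR; lia.
have memU (r : 'I_n) : r \in u |: R -> r = u \/ r \in R.
  by rewrite in_setU1 => /orP[/eqP|]; [left|right].
have ltU (r : 'I_n) : r \in u |: R -> r <= t by case/memU=> [-> |/ltRt/ltnW] //; rewrite ut.
have memR (r s : 'I_n) : r \in u |: R -> s \in u |: R -> r < s -> r \in R.
  by case/memU=> [->|//] /ltU; lia.
(* Neither blue rule applies, so [u] turns red; being rightmost, it could only be the final 3 of a
   new 2143. *)
exists (u |: R); split.
- by rewrite subUset sub1set uA.
- by move=> r /ltU.
- move=> a b x y aU bU xU yU /andP[ab bx] xy pab pyx.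
  have [aR bR] := (memR a b aU bU ab, memR b x bU xU bx).
  have xR := memR x y xU yU xy.
  have [yu | yR] := memU y yU; last by apply: (avR a b x y); rewrite ?ab.
  case/negP: no_red; apply/existsP; exists a; apply/existsP; exists b.
  by apply/existsP; exists x; rewrite aR bR xR ab bx -yu pab.
- move=> b r; rewrite !inE negb_or -andbA => /and3P[bu bR bA] bt.
  have {}bt : b < t.
    by rewrite ltn_neqAle -ltnS bt andbT; apply: contra bu => /eqP/u_uniq->.
  have bB : b \in A :\: R by rewrite inE bR.
  case/orP=> [/eqP-> _ | ]; last exact: aboveR.
  rewrite ltnNge; apply/negP => pbu; case/negP: no_blue; apply/existsP; exists b.
  rewrite bB bt ltn_neqAle pbu andbT /=; apply: contra bu => /eqP pbu'.
  by apply/eqP/(@perm_inj _ p)/val_inj.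
move=> b; rewrite inE in_setU1 negb_or -andbA => /and3P[bu bR bA] bt.
have {}bt : b < t.
  by rewrite ltn_neqAle -ltnS bt andbT; apply: contra bu => /eqP/u_uniq->.
have bB : b \in A :\: R by rewrite inE bR.
have [b' [x [y [z [b'B /and3P[xR yR zR] pos pyx pb'b]]]]] := blueR b bB bt.
exists b', x, y, z; split=> //; last by rewrite !inE xR yR zR !orbT.
move: b'B; rewrite !inE => /andP[b'R ->]; rewrite andbT negb_or b'R andbT.
apply/eqP => b'u; case/and4P: pos => _ _ _.
by rewrite b'u ut leqNgt bt.
Qed.

(** A witness supplies a red 21 that lengthens any blue occurrence by one block. *)
Lemma occurs_split m p A : ~ occurs m.+1 p A 0 0 ->
  exists R, [/\ R \subset A, avoids2143 p R & ~ occurs m p (A :\: R) 0 0].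
Proof.
move=> noA; have [R [sRA ltR avR aboveR blueR]] := greedy_exists p A n.
have inA r : r \in R -> r \in A by move/(subsetP sRA).
have blueA b : b \in A :\: R -> b \in A by rewrite inE => /andP[].
exists R; split=> // E; apply: noA; case: m E => [|m] /=.
  (* For a single blue entry, the witness [x y z] is already a 213. *)
  case=> b bB _; have [b' [x [y [z [b'B /and3P[xR yR zR] pos pyx pb'b]]]]] :=
    blueR b bB (ltn_ord b).
  exists x, y; split; try exact: inA; try lia.
  by exists z; [exact: inA | lia].
case=> d [c [dB cB dc pcd E]].
have [c' [x [y [z [c'B /and3P[xR yR zR] pos pyx pc'c]]]]] :=
  blueR c cB (ltn_ord c).
exists x, y; split; try exact: inA; try lia.
have [yd | dy] := ltnP y d.
  exists d, c; split; try exact: blueA; try lia.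
  by apply: occurs_mono E => //; exact: subsetDl.
(* The red entry z lies right of the blue d, hence below it, so z and c' can
   replace d and c. *)
have pzd : p z < p d by apply: aboveR => //; lia.
exists z, c'; split; [exact: inA | exact: blueA | lia | lia | ].
by apply: occurs_mono E; rewrite ?subsetDl //; lia.
Qed.

(** * Coding 2143-avoiders by three classes *)

(* Class 2: entries with a 21 to their upper right; class 1: other entries that
   are not left-to-right minima of classes 0 and 1; class 0: these minima. *)
Definition tricoloring p R d : Prop :=
  [/\ avoids2143 p R,
      forall i, i \in R -> d i = 2 -> exists x y,
        [/\ x \in R, y \in R, i < x < y & p i < p y < p x],
      forall i x y, i \in R -> x \in R -> y \in R ->
        d i < 2 -> d x < 2 -> d y < 2 ->
        i < x < y -> p i < p y < p x -> False,
      forall i, i \in R -> d i = 1 -> exists j,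
        [/\ j \in R, d j < 2, j < i & p j < p i]
    & forall i j, i \in R -> j \in R -> d i = 0 -> d j = 0 -> i < j -> p j < p i].

Lemma tricoloring_exists p R : avoids2143 p R ->
  exists2 d, tricoloring p R d & forall i, d i < 3.
Proof.
move=> avR.
pose W (i : 'I_n) := [exists x : 'I_n, exists y : 'I_n,
  [&& x \in R, y \in R, i < x < y & p i < p y < p x]].
pose K1 (i : 'I_n) := [exists j : 'I_n, [&& j \in R, ~~ W j, j < i & p j < p i]].
pose d i := if W i then 2 else if K1 i then 1 else 0.
have dlt2 i : (d i < 2) = ~~ W i by rewrite /d; case: (W i) (K1 i) => [] [].
exists d; last by move=> i; rewrite /d; case: (W i) (K1 i) => [] [].
split=> //.
- move=> i iR; rewrite /d; case: ifP => [/existsP[x /existsP[y /and4P[]]] | _].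
    by move=> *; exists x, y.
  by case: ifP.
- move=> i x y iR xR yR; rewrite dlt2 => /negP Wi _ _ ixy pixy; apply: Wi.
  by apply/existsP; exists x; apply/existsP; exists y; apply/and4P.
- move=> i iR; rewrite /d; case: ifP => // _; case: ifP => // /existsP[j].
  by case/and4P=> jR Wj ji pji _; exists j; rewrite -/(d j) dlt2.
move=> i j iR jR di dj ij; rewrite ltnNge; apply/negP => pij.
have Wi : ~~ W i by rewrite -dlt2 di.
suff K1j : K1 j by move: dj; rewrite /d K1j; case: ifP.
apply/existsP; exists i; rewrite iR Wi ij /= ltn_neqAle pij andbT.
apply/eqP => /val_inj/perm_inj eij; by move: ij; rewrite eij ltnn.
Qed.

(* Positions are scanned by decreasing f, so i is the first one where p and q
   differ; g allows reversing the order of the values. *)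
Lemma scan_unique (f g : 'I_n -> nat) p q X :
  injective f -> injective g -> p @: X = q @: X ->
  (forall r s i j, (r, s) = (p, q) \/ (r, s) = (q, p) ->
     i \in X -> j \in X ->
     (forall i', i' \in X -> f i < f i' -> r i' = s i') ->
     f j < f i -> g (r i) < g (s i) -> r j = s i -> False) ->
  {in X, p =1 q}.
Proof.
move=> f_inj g_inj eqX H i0 i0X; apply/eqP; apply/negPn/negP => ne0.
pose P i := (i \in X) && (p i != q i).
have P0 : P i0 by rewrite /P i0X.
case: (arg_maxnP f P0) => i /andP[iX nei] i_max.
have agree i' : i' \in X -> f i < f i' -> p i' = q i'.
  move=> i'X lt_i; apply/eqP; apply/negPn/negP => ne'.
  by have := i_max i'; rewrite /P i'X ne' => /(_ isT) /=; rewrite leqNgt lt_i.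
(* [r] takes the value [s i] at some [j], not yet scanned because [r] and [s] agree on the scanned
   positions. *)
have key r s : (r, s) = (p, q) \/ (r, s) = (q, p) ->
    s @: X \subset r @: X ->
    (forall i', i' \in X -> f i < f i' -> r i' = s i') ->
    g (r i) < g (s i) -> False.
  move=> rs sX ag lt_g; have /(subsetP sX)/imsetP[j jX sij] := imset_f s iX.
  apply: (H r s i j rs iX jX ag _ lt_g (esym sij)).
  case: (ltngtP (f j) (f i)) => // [ltij | /f_inj eqij].
    by have ij := perm_inj (etrans sij (ag j jX ltij)); rewrite ij ltnn in ltij.
  by move: lt_g; rewrite sij eqij ltnn.
case: (ltngtP (g (p i)) (g (q i))) => [lt_g | lt_g | /g_inj/eqP].
- by apply: (key p q) => //; [left | rewrite eqX].
- apply: (key q p) => //; [by right | by rewrite eqX |].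
  by move=> i' i'X /(agree i' i'X).
by rewrite (negPf nei).
Qed.

Lemma tricoloring_unique p q R d :
  tricoloring p R d -> tricoloring q R d -> {in R, forall i, d i < 3} ->
  (forall k, p @: [set i in R | d i == k] = q @: [set i in R | d i == k]) ->
  {in R, p =1 q}.
Proof.
move=> Tp Tq d3 eqX.
have T r s : (r, s) = (p, q) \/ (r, s) = (q, p) ->
    tricoloring r R d /\ tricoloring s R d by case=> [] [-> ->].
have rev_inj : injective (fun i : 'I_n => n - i).
  move=> i j /= eij; apply: val_inj => /=.
  by have := ltn_ord i; have := ltn_ord j; lia.
have ord_inj : injective (fun i : 'I_n => i : nat) by exact: val_inj.
have rev_lt (i j : 'I_n) : (n - i < n - j) = (j < i).
  by have := ltn_ord i; have := ltn_ord j; lia.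
have eq0 : {in R, forall i, d i = 0 -> p i = q i}.
  suff H : {in [set i in R | d i == 0], p =1 q}.
    by move=> i iR di; apply: H; rewrite inE iR di.
  (* Right to left, with [s i < r i]: then [r j < r i] for some [j] left of [i], but class 0
     decreases. *)
  apply: (scan_unique ord_inj rev_inj (eqX 0)) => r s i j /T[[_ _ _ _ dec] _].
  rewrite !inE => /andP[iR /eqP di] /andP[jR /eqP dj] _ ji.
  by rewrite rev_lt => lt_s rj; have := dec j i jR iR dj di ji; rewrite rj; lia.
have eq1 : {in R, forall i, d i = 1 -> p i = q i}.
  suff H : {in [set i in R | d i == 1], p =1 q}.
    by move=> i iR di; apply: H; rewrite inE iR di.
  (* Left to right, with [s i < r i]: an earlier entry [k] below [i] in [s] already agrees, and
     [k i j] is a 132 in [r]. *)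
  apply: (scan_unique rev_inj rev_inj (eqX 1)) => r s i j rs.
  rewrite !inE => /andP[iR /eqP di] /andP[jR /eqP dj] agree.
  rewrite !rev_lt => ij lt_s rj.
  have [[_ _ no132 _ _] [_ _ _ has_min _]] := T r s rs.
  have [k [kR dk ki ski]] := has_min i iR di.
  have rk : r k = s k.
    have [dk0|dk1] : d k = 0 \/ d k = 1 by lia.
      by case: rs => [] [-> ->]; rewrite eq0.
    by apply: agree; rewrite ?rev_lt ?inE ?kR ?dk1.
  apply: (no132 k i j) => //; rewrite ?di ?dj // ?rk ?rj; lia.
suff eq2 : {in R, forall i, d i = 2 -> p i = q i}.
  move=> i iR; have := d3 i iR.
  by case di: (d i) => [|[|[|]]] // _; [apply: eq0 | apply: eq1 | apply: eq2].
suff H : {in [set i in R | d i == 2], p =1 q}.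
  by move=> i iR di; apply: H; rewrite inE iR di.
(* Right to left, with [r i < s i]: [r] shares the 21 that [s] has to the upper right of [i], so
   [j i x y] is a 2143 in [r]. *)
apply: (scan_unique ord_inj ord_inj (eqX 2)) => r s i j rs.
rewrite !inE => /andP[iR /eqP di] /andP[jR /eqP dj] agree ji lt_s rj.
have [[no2143 _ _ _ _] [_ has21 _ _ _]] := T r s rs.
have [x [y [xR yR ixy sixy]]] := has21 i iR di.
have eq_r z : z \in R -> i < z -> r z = s z.
  move=> zR iz; have := d3 z zR; case dz: (d z) => [|[|[|]]] // _.
  - by case: rs => [] [-> ->]; rewrite eq0.
  - by case: rs => [] [-> ->]; rewrite eq1.
  - by apply: agree; rewrite ?inE ?zR ?dz.
by apply: (no2143 j i x y) => //; rewrite ?rj ?(eq_r x) ?(eq_r y) //; lia.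
Qed.

(** * Iterated coding of avoiders *)

(** The top three colours mark the red part split off first, the colours below [3 * m'] the blue
    rest. At [m = 0] the avoided pattern is a single entry, so nothing is left. *)
Fixpoint coding m p A c : Prop :=
  if m is m'.+1 then
    [/\ {in A, forall i, c i < 3 * m},
        tricoloring p [set i in A | 3 * m' <= c i] (fun i => c i - 3 * m')
      & coding m' p [set i in A | c i < 3 * m'] c]
  else A = set0.

Lemma coding_lt m p A c : coding m p A c -> {in A, forall i, c i < 3 * m}.
Proof. by case: m => [-> i | m [? _ _] //]; rewrite inE. Qed.

Lemma eq_tricoloring p R d d' : {in R, d =1 d'} ->
  tricoloring p R d -> tricoloring p R d'.
Proof.
move=> eqd [h1 h2 h3 h4 h5]; split=> //.
- by move=> i iR; rewrite -eqd //; exact: h2.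
- by move=> i x y iR xR yR; rewrite -!eqd //; exact: h3.
- move=> i iR; rewrite -eqd // => /(h4 i iR)[j [jR dj ji pji]].
  by exists j; rewrite -eqd.
by move=> i j iR jR; rewrite -!eqd //; exact: h5.
Qed.

Lemma eq_coding m p A c c' : {in A, c =1 c'} -> coding m p A c -> coding m p A c'.
Proof.
elim: m A => [|m IHm] A //= eqc [clt tri cod].
have eqset (P : pred nat) : [set i in A | P (c' i)] = [set i in A | P (c i)].
  by apply/setP => i; rewrite !inE; case iA: (i \in A); rewrite //= eqc.
split.
- by move=> i iA; rewrite -eqc // clt.
- rewrite (eqset (leq (3 * m))); apply: eq_tricoloring tri => i.
  by rewrite inE => /andP[iA _]; rewrite eqc.
rewrite (eqset (fun k => k < 3 * m)); apply: IHm cod => i.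
by rewrite inE => /andP[iA _]; rewrite eqc.
Qed.

Lemma coding_exists m p A : ~ occurs m p A 0 0 -> exists c, coding m p A c.
Proof.
elim: m A => [|m IHm] A.
  move=> noA; exists (fun=> 0); apply/setP => i; rewrite inE.
  by apply/negP => iA; apply: noA; exists i.
case/occurs_split=> R [sRA /tricoloring_exists[d tri d3] /IHm[c cod]].
have clt := coding_lt cod.
pose c' i := if i \in R then 3 * m + d i else c i.
have c'D i : i \in A :\: R -> c' i = c i.
  by rewrite inE /c' => /andP[/negPf->].
have eqR : [set i in A | 3 * m <= c' i] = R.
  apply/setP => i; rewrite inE /c'; case: (boolP (i \in R)) => iR.
    by rewrite (subsetP sRA) //= leq_addr.
  case iA: (i \in A) => //=; apply/negbTE; rewrite -ltnNge clt //.
  by rewrite inE iR.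
have eqD : [set i in A | c' i < 3 * m] = A :\: R.
  apply/setP => i; have /setP/(_ i) := eqR; rewrite !inE => <-.
  by rewrite ltnNge; case: (i \in A); rewrite ?andbF ?andbT.
exists c'; split.
- move=> i iA; rewrite /c'; case: (boolP (i \in R)) => iR.
    by have := d3 i; lia.
  by have := clt i; rewrite inE iR iA => /(_ isT); lia.
- rewrite eqR; apply: eq_tricoloring tri => i iR; rewrite /c' iR; lia.
by rewrite eqD; apply: eq_coding cod => i /c'D.
Qed.

Lemma coding_unique m p q A c : coding m p A c -> coding m q A c ->
  (forall k, p @: [set i in A | c i == k] = q @: [set i in A | c i == k]) ->
  {in A, p =1 q}.
Proof.
elim: m A => [|m IHm] A; first by move=> /= -> _ _ i; rewrite inE.
case=> clt tri_p cod_p [_ tri_q cod_q] eqX i iA.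
have [lt_c | ge_c] := ltnP (c i) (3 * m).
  apply: (IHm _ cod_p cod_q); last by rewrite inE iA.
  move=> k; have [lt_k | ge_k] := ltnP k (3 * m).
    suff -> : [set j in [set j in A | c j < 3 * m] | c j == k]
              = [set j in A | c j == k] by [].
    by apply/setP => j; rewrite !inE -andbA; case: eqP => [->|]; rewrite ?lt_k ?andbF.
  suff -> : [set j in [set j in A | c j < 3 * m] | c j == k] = set0.
    by rewrite !imset0.
  apply/setP => j; rewrite !inE; case: eqP => [->|_]; last by rewrite andbF.
  by rewrite ltnNge ge_k andbF.
apply: (tricoloring_unique tri_p tri_q); last by rewrite inE iA.
  by move=> j; rewrite inE => /andP[/clt]; lia.
move=> k.
suff -> : [set j in [set j in A | 3 * m <= c j] | c j - 3 * m == k]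
          = [set j in A | c j == 3 * m + k] by [].
apply/setP => j; rewrite !inE -andbA; congr andb.
by apply/andP/eqP => [[? /eqP] | ->]; last split; lia.
Qed.

(** * Counting codes *)

(** A code pairs the colouring of the positions with the induced one of the values. One colour
    beyond the [3 * m] in use keeps the colour type inhabited at [m = 0]. *)
Lemma num_avoiders_M_odd m :
  num_avoiders n (M m.*2.+1) <= ((3 * m).+1 ^ 2) ^ n.
Proof.
have ex_code p : exists c : {ffun 'I_n -> 'I_(3 * m).+1},
    avoids p (M m.*2.+1) -> coding m p setT (fun i => c i).
  have [av | _] := boolP (avoids p (M m.*2.+1)); last by exists [ffun=> ord0].
  have [|c cod] := @coding_exists m p setT.
    by move/occurs_contains; apply/negP.
  have c_lt := coding_lt cod.
  exists [ffun i => inord (c i)] => _; apply: eq_coding cod => i _.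
  by rewrite ffunE inordK // ltnS ltnW // c_lt.
have [C codC] := fin_all_exists ex_code.
pose code p := (C p, [ffun v => C p (p^-1%g v)]).
have code_inj : {in [set p | avoids p (M m.*2.+1)] &, injective code}.
  move=> p q; rewrite !inE => /codC cod_p /codC cod_q [eqC eqV].
  rewrite -eqC in cod_q; apply/permP => i.
  apply: (coding_unique cod_p cod_q _ (in_setT i)) => k.
  (* The values of colour [k] are the image of the positions of colour [k], so equal codes give
     equal images. *)
  have imE (r : 'S_n) : C r = C p ->
      r @: [set i in setT | val (C p i) == k]
      = [set v | val ([ffun v => C r (r^-1%g v)] v) == k].
    move=> eqr; apply/setP => v; rewrite inE ffunE eqr.
    apply/imsetP/idP => [[j] | vk].
      by rewrite !inE => /= jk ->; rewrite permK.
    by exists (r^-1%g v); rewrite ?permKV // !inE.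
  by rewrite (imE p) // (imE q) // eqV.
rewrite /num_avoiders -(card_in_imset code_inj); apply: leq_trans (max_card _) _.
by rewrite card_prod card_ffun !card_ord -mulnn expnMn.
Qed.

End Coding.

Theorem corollary4p4 (k n : nat) (k_odd : odd k) (n_gt0 : (0 < n)%N) :
  (num_avoiders n (M k))%:R <= (2.25%Q * k%:R ^+ 2) ^+ n :> rat.
Proof.
have -> : k = (k./2).*2.+1 by rewrite -{1}(odd_double_half k) k_odd.
set m := k./2.
apply: le_trans (_ : (((3 * m).+1 ^ 2) ^ n)%:R <= _).
  by rewrite ler_nat num_avoiders_M_odd.
rewrite natrX; apply: lerXn2r; rewrite ?nnegrE ?ler0n //.
  by rewrite mulr_ge0 // sqr_ge0.
(* This amounts to [3 * m + 1 <= 3 / 2 * (2 * m + 1)], squared. *)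
rewrite natrX -mul2n -[(3 * m).+1%:R]natr1 -[(2 * m).+1%:R]natr1 !natrM.
have -> : 2.25%Q = 9 / 4 :> rat by exact/eqP.
have : 0 <= m%:R :> rat by rewrite ler0n.
nra.
Qed.
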